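(* In a triangulated structure in the plane, let $E_{02}=V_0V_2$ be an interior edge that is bounded on opposite sides by two nondegenerate triangles $V_0V_1V_2$ and $V_0V_2V_3$. Suppose further that all four of $V_0,V_1,V_2,V_3$ are interior vertices. Then in the sum of the four wagon wheel conditions that involve $E_{02}$, namely those centered at $V_0,V_1,V_2$ and $V_3$, the coefficient of the elongation $L_{02}$ of $E_{02}$ is zero.
   Context: A triangulated structure consists of the vertices and (straight) edges of a piecewise linear triangulation of a planar domain: a tiling by finitely many non-overlapping closed triangles that meet only in a common vertex or along a whole common edge. Wagon wheel condition: for an interior vertex $W_0$ with adjacent vertices $W_1,\dots,W_n$ in cyclic order (indices mod $n$), the wagon wheel functional centered at $W_0$ is the linear functional of the edge elongations $$\sum_{i=1}^n\frac{L_{W_iW_{i+1}}}{h_i}-\sum_{i=1}^n\left\{\frac{\cos\beta_i}{h_i}+\frac{\cos\gamma_i}{h_{i-1}}\right\}L_{W_0W_i},$$ where $\beta_i=\angle W_0W_iW_{i+1}$, $\gamma_i=\angle W_0W_iW_{i-1}$, and $h_i$ is the distance from $W_0$ to the line $W_iW_{i+1}$; the wagon wheel condition is that this functional vanishes. The sum of conditions means the sum of these functionals. *)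

(* Defs.v *)
From HB Require Import structures.
From mathcomp Require Import all_boot all_order all_algebra.
From mathcomp Require Import all_classical all_reals all_analysis.

Set Implicit Arguments.
Unset Strict Implicit.
Unset Printing Implicit Defensive.

Import Order.TTheory GRing.Theory Num.Theory numFieldNormedType.Exports.
Local Open Scope ring_scope.

Section Plane.
Context {R : realType}.
Implicit Types (u v a b c p : 'rV[R]_2).

Definition dot u v : R := \sum_(i < 2) u 0 i * v 0 i.

(* The library norm on 'rV[R]_2 is the sup norm. *)
Definition enorm u : R := Num.sqrt (dot u u).

Definition cross u v : R := u 0 0 * v 0 1 - u 0 1 * v 0 0.

(* The angle at b. *)
Definition angle a b c : R :=
  acos (dot (a - b) (c - b) / (enorm (a - b) * enorm (c - b))).

Definition dist_line p a b : R :=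
  inf [set d | exists t : R, d = enorm (p - (a + t *: (b - a)))]%classic.

Definition nondegenerate_tri a b c : Prop := cross (b - a) (c - a) != 0.

(* c and p lie strictly on opposite sides of the line ab. *)
Definition opposite_sides a b c p : Prop :=
  cross (b - a) (c - a) * cross (b - a) (p - a) < 0.

Definition polar (r theta : R) : 'rV[R]_2 :=
  r *: \row_(j < 2) (if j == 0 then cos theta else sin theta).

Definition hull (V : finType) (pos : V -> 'rV[R]_2) (A : {set V}) :
    set 'rV[R]_2 :=
  [set p | exists w : V -> R,
     [/\ forall x, 0 <= w x, \sum_(x in A) w x = 1
       & p = \sum_(x in A) w x *: pos x]]%classic.

End Plane.

(* A triangle is recorded by its set of three vertices.  Two distinct triangles
   share at most two vertices, so [tri_meet] says that their closed hulls are
   disjoint or meet exactly in a common vertex or in a whole common edge. *)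
Record triangulation (R : realType) := Triangulation {
  vertex : finType;
  pos : vertex -> 'rV[R]_2;
  triangles : {set {set vertex}};
  pos_inj : injective pos;
  tri_card : forall t, t \in triangles -> #|t| = 3%N;
  tri_nondeg : forall x y z, [set x; y; z] \in triangles ->
    nondegenerate_tri (pos x) (pos y) (pos z);
  tri_cover : forall x, exists2 t, t \in triangles & x \in t;
  tri_meet : forall s t, s \in triangles -> t \in triangles -> s != t ->
    (hull pos s `&` hull pos t)%classic = hull pos (s :&: t)
}.
Arguments pos {R} t0 _.
Arguments triangles {R} t0.

Section Structure.
Context {R : realType} (T : triangulation R).
Implicit Types (x y c : vertex T).

Definition domain : set 'rV[R]_2 :=
  [set p | exists2 t, t \in triangles T & hull (pos T) t p]%classic.

Definition adjacent x y : Prop :=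
  x != y /\ exists2 t, t \in triangles T & (x \in t) && (y \in t).

Definition interior_vertex x : Prop := interior domain (pos T x).

Definition interior_edge x y : Prop :=
  adjacent x y /\
  forall t : R, 0 < t < 1 ->
    interior domain (pos T x + t *: (pos T y - pos T x)).

Definition counterclockwise c n (W : 'I_n -> vertex T) : Prop :=
  exists r theta : 'I_n -> R,
    [/\ forall i, 0 < r i /\ pos T (W i) - pos T c = polar (r i) (theta i),
        forall i j : 'I_n, (i < j)%N -> theta i < theta j
      & forall i j, theta j < theta i + 2 * pi].

(* W lists the vertices adjacent to c, each once, in the order in which they are
   met when turning once around c in either direction. *)
Definition cyclic_order c n (W : 'I_n -> vertex T) : Prop :=
  [/\ injective W,
      forall x, adjacent c x <-> exists i, W i = x
    & counterclockwise c W \/ counterclockwise c (fun i => W (rev_ord i))].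

(* An elongation assigns a number to every edge, an edge being the pair of its
   endpoints; values at pairs that are not edges are never used. *)
Definition elongations : lmodType R := {ffun {set vertex T} -> R^o}.

Section Wheel.
Variables (c : vertex T) (n : nat) (W : 'I_n -> vertex T).

Let h (i : 'I_n) : R := dist_line (pos T c) (pos T (W i)) (pos T (W (ordS i))).
Let beta (i : 'I_n) : R :=
  angle (pos T c) (pos T (W i)) (pos T (W (ordS i))).
Let gamma (i : 'I_n) : R :=
  angle (pos T c) (pos T (W i)) (pos T (W (ord_pred i))).

Definition wagon_wheel (L : elongations) : R^o :=
  \sum_(i < n) L [set W i; W (ordS i)] / h i
  - \sum_(i < n) (cos (beta i) / h i + cos (gamma i) / h (ord_pred i))
                 * L [set c; W i].

Fact wagon_wheel_is_linear : linear wagon_wheel.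
Proof.
move=> a L M; rewrite /wagon_wheel scalerBr !scaler_sumr addrACA -opprD.
rewrite -!big_split /=; congr (_ - _); apply: eq_bigr => i _; rewrite !ffunE.
  by rewrite /GRing.scale /= mulrDl mulrA.
by rewrite /GRing.scale /= mulrDr mulrCA.
Qed.

HB.instance Definition _ := GRing.isLinear.Build R elongations R^o *:%R
  wagon_wheel wagon_wheel_is_linear.

End Wheel.

(* The coefficient of the coordinate L_xy in the linear functional F is the
   value of F at the elongation that is 1 at xy and 0 elsewhere. *)
Definition coefficient (F : {linear elongations -> R^o}) x y : R :=
  F [ffun e => (e == [set x; y])%:R].

End Structure.

(* Main.v *)
(* The two cosine terms of [L_02] in the wheel at [V_0] are divided by the heights
   from [V_0] on [V_1V_2] and [V_2V_3], and similarly at [V_2].  In a triangle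
   with sides [l_a, l_b, l_c], opposite angles [A, B, C] and twice the area [D], the
   heights are [h_a = D / l_a] and so on, so [l_c = l_a cos B + l_b cos A] divided
   by [D] reads [1 / h_c = cos B / h_a + cos A / h_b]: in each of the two triangles the rim term
   cancels the spoke terms.
   That the wheels contain exactly these terms is a matter of showing that two
   vertices spanning a triangle with the centre are consecutive in cyclic order:
   an edge strictly inside the angle of a triangle at the centre would overlap
   its interior.  Moreover a wheel about an interior vertex has at least three
   rim vertices, so a rim edge is not counted twice. *)

Require Import Defs.
From mathcomp Require Import all_boot all_order all_algebra.
From mathcomp Require Import all_classical all_reals all_analysis.
From mathcomp Require Import ring lra zify.
Import Order.TTheory GRing.Theory Num.Theory numFieldNormedType.Exports.
Local Open Scope ring_scope.

Set Implicit Arguments.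
Unset Strict Implicit.
Unset Printing Implicit Defensive.

(** * Heights and angles of a triangle *)

Lemma rV2P (R : realType) (u v : 'rV[R]_2) :
  u 0 0 = v 0 0 -> u 0 1 = v 0 1 -> u = v.
Proof.
move=> e0 e1; apply/rowP => i.
by have [->|->] : i = 0 \/ i = 1 by
  case: i => [[|[|//]]] ?; [left|right]; apply: val_inj.
Qed.

Lemma dotE (R : realType) (u v : 'rV[R]_2) :
  dot u v = u 0 0 * v 0 0 + u 0 1 * v 0 1.
Proof.
by rewrite /dot big_ord_recl big_ord1; congr (_ + _ * _); congr (_ _ _);
  apply: val_inj.
Qed.

Lemma dot_ge0 (R : realType) (u : 'rV[R]_2) : 0 <= dot u u.
Proof. by rewrite dotE addr_ge0 // -expr2 sqr_ge0. Qed.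

Lemma sqr_enorm (R : realType) (u : 'rV[R]_2) : enorm u ^+ 2 = dot u u.
Proof. by rewrite sqr_sqrtr ?dot_ge0. Qed.

Lemma enorm_ge0 (R : realType) (u : 'rV[R]_2) : 0 <= enorm u.
Proof. exact: sqrtr_ge0. Qed.

Lemma enorm_eq0 (R : realType) (u : 'rV[R]_2) : (enorm u == 0) = (u == 0).
Proof.
apply/idP/eqP => [|->]; last by rewrite /enorm dotE !mxE !mul0r addr0 sqrtr0.
rewrite -sqrf_eq0 sqr_enorm dotE -!expr2 paddr_eq0 ?sqr_ge0 // !sqrf_eq0.
by case/andP => /eqP e0 /eqP e1; apply: rV2P; rewrite mxE.
Qed.

Lemma enorm_gt0 (R : realType) (u : 'rV[R]_2) : (0 < enorm u) = (u != 0).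
Proof. by rewrite lt_def enorm_eq0 enorm_ge0 andbT. Qed.

Lemma enormN (R : realType) (u : 'rV[R]_2) : enorm (- u) = enorm u.
Proof. by rewrite /enorm !dotE !mxE !mulrNN. Qed.

(** Dropping the [cross] term gives Cauchy-Schwarz, for [cos_angle]; dropping the [dot] term gives
    the lower bound on distances, sharp for orthogonal vectors. *)
Lemma lagrange (R : realType) (u v : 'rV[R]_2) :
  dot u v ^+ 2 + cross u v ^+ 2 = (enorm u * enorm v) ^+ 2.
Proof. by rewrite exprMn !sqr_enorm !dotE /cross; ring. Qed.

Lemma cos_angle (R : realType) (a b c : 'rV[R]_2) :
  cos (angle a b c) = dot (a - b) (c - b) / (enorm (a - b) * enorm (c - b)).
Proof.
apply: acosK; rewrite in_itv /= -ler_norml normrM normfV.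
set N := enorm _ * enorm _; have N0 : 0 <= N by rewrite mulr_ge0 ?enorm_ge0.
(* If an arm of the angle is zero, the quotient is 0 by the convention on [0^-1], which is still in
   the range of the cosine. *)
rewrite (ger0_norm N0); have [->|Nn0] := eqVneq N 0; first by rewrite invr0 mulr0.
rewrite ler_pdivrMr ?lt_def ?Nn0 // mul1r -ler_sqr ?nnegrE // real_normK ?num_real //.
by rewrite -lagrange lerDl sqr_ge0.
Qed.

(** Twice the area over the base: the infimum is attained at the foot of the perpendicular. *)
Lemma dist_lineE (R : realType) (p a b : 'rV[R]_2) : a != b ->
  dist_line p a b = `|cross (b - a) (p - a)| / enorm (b - a).
Proof.
move=> ab; set u := b - a; set q := p - a.
have u0 : 0 < enorm u by rewrite enorm_gt0 subr_eq0 eq_sym.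
rewrite /dist_line; set S := (X in inf X).
(* The cross product with [u] is constant as the point moves along the line. *)
have lbS : lbound S (`|cross u q| / enorm u).
  move=> _ [t ->]; rewrite ler_pdivrMr // mulrC.
  rewrite -ler_sqr ?nnegrE ?mulr_ge0 ?enorm_ge0 // real_normK ?num_real //.
  have <- : cross u (p - (a + t *: u)) = cross u q by rewrite /cross /u /q !mxE; ring.
  by rewrite -lagrange lerDr sqr_ge0.
have Sm : S (`|cross u q| / enorm u).
  (* [t] is the parameter of the orthogonal projection of [p] on the line. *)
  set t := dot u q / enorm u ^+ 2; exists t; set v := p - _.
  have duv : dot u v = 0.
    have : dot u v = dot u q - t * dot u u.
      by rewrite !dotE /v /q /u !mxE; ring.
    by rewrite -sqr_enorm /t divfK ?subrr // expf_neq0 ?gt_eqF.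
  have cuv : cross u v = cross u q by rewrite /cross /v /u /q !mxE; ring.
  have := lagrange u v; rewrite duv cuv expr0n add0r => /(congr1 Num.sqrt).
  rewrite !sqrtr_sqr => ->; rewrite ger0_norm ?mulr_ge0 ?enorm_ge0 //.
  by rewrite mulrC mulKf ?gt_eqF.
apply/eqP; rewrite eq_le; apply/andP; split.
  by apply: inf_lbound => //; exists (`|cross u q| / enorm u).
by apply: lb_le_inf => //; exists (`|cross u q| / enorm u).
Qed.

Lemma dist_lineC (R : realType) (p a b : 'rV[R]_2) :
  dist_line p a b = dist_line p b a.
Proof.
have [->//|ab] := eqVneq a b; rewrite !dist_lineE // 1?eq_sym //.
rewrite -(opprB b a) enormN -normrN; congr (`|_| / _).
by rewrite /cross !mxE; ring.
Qed.

Lemma nondegenerate_neq (R : realType) (a b c : 'rV[R]_2) :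
  nondegenerate_tri a b c -> [/\ a != b, a != c & b != c].
Proof.
by move=> nd; split; apply: contraNneq nd => ->; rewrite /cross !mxE; apply/eqP; ring.
Qed.

Lemma rim_spoke (R : realType) (a b c : 'rV[R]_2) : nondegenerate_tri a b c ->
  (dist_line c a b)^-1 = cos (angle a b c) / dist_line a b c
                         + cos (angle b a c) / dist_line b a c.
Proof.
move=> nd.
have [ab ac bc] := nondegenerate_neq nd.
have enorm_neq0 x y : x != y -> enorm (y - x) != 0 :> R.
  by rewrite enorm_eq0 subr_eq0 eq_sym.
set D := cross (b - a) (c - a) in nd.
rewrite !dist_lineE // !cos_angle.
rewrite (_ : cross (c - b) (a - b) = D); last by rewrite /D /cross !mxE; ring.
rewrite (_ : cross (c - a) (b - a) = - D); last by rewrite /D /cross !mxE; ring.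
rewrite normrN -/D -(opprB b a) enormN.
(* This is [l_c = l_a cos B + l_b cos A] multiplied by [l_c], with [l_c] the length of [b - a]. *)
have eD : enorm (b - a) ^+ 2 = dot (-(b - a)) (c - b) + dot (b - a) (c - a).
  by rewrite sqr_enorm !dotE !mxE; ring.
have n1 := enorm_neq0 _ _ ab; have n2 := enorm_neq0 _ _ bc.
have n3 := enorm_neq0 _ _ ac.
have nD : `|D| != 0 by rewrite normr_eq0.
apply: (mulfI n1).
transitivity (enorm (b - a) ^+ 2 / `|D|); first by field; rewrite nD n1.
by rewrite eD; field; rewrite nD n1 n2 n3.
Qed.

(** * Directions listed in increasing order *)

Lemma cross_polar (R : realType) (r s x y : R) :
  cross (polar r x) (polar s y) = r * s * sin (y - x).
Proof. by rewrite /cross /polar !mxE /= sinB; ring. Qed.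

Lemma sin_lt0_piDpi (R : realType) (x : R) : pi < x < 2 * pi -> sin x < 0.
Proof.
move=> /andP[x1 x2]; rewrite -(subrK pi x) sinDpi oppr_lt0.
by apply: sin_gt0_pi; apply/andP; split; lra.
Qed.

Lemma sin_lt0_Npi (R : realType) (x : R) : - pi < x < 0 -> sin x < 0.
Proof.
move=> /andP[x1 x2]; rewrite -(opprK x) sinN oppr_lt0.
by apply: sin_gt0_pi; apply/andP; split; lra.
Qed.

(** The last hypothesis but one says that no direction lies strictly inside the convex sector of [a]
    and [b]; the products of sines make it independent of orientation. A gap below [pi] puts this
    sector between the two angles; a gap above [pi] makes it wrap around, so [b] is the last index
    and [a] the first. *)
Lemma angles_consecutive_lt (R : realType) (n : nat) (theta : 'I_n -> R)
    (a b : 'I_n) :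
  (forall i j : 'I_n, (i < j)%N -> theta i < theta j) ->
  (forall i j, theta j < theta i + 2 * pi) ->
  sin (theta b - theta a) != 0 ->
  (forall k, ~ (0 < sin (theta b - theta a) * sin (theta k - theta a) /\
                0 < sin (theta b - theta a) * sin (theta b - theta k))) ->
  (a < b)%N -> b = ordS a \/ a = ordS b.
Proof.
move=> inc win nz emp ab.
have := inc _ _ ab; have := win a b => wab tab.
have [lt_pi|gt_pi|eq_pi] := ltgtP (theta b - theta a) pi; last first.
- by rewrite eq_pi sinpi eqxx in nz.
- have sab : sin (theta b - theta a) < 0 by apply: sin_lt0_piDpi; apply/andP; split; lra.
  right; apply: val_inj => /=.
  have b_last : b.+1 = n.
    apply/eqP; rewrite eqn_leq ltn_ord leqNgt; apply/negP => bn.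
    pose k := Ordinal bn.
    (* An index after [b] would have its angle between [theta b] and [theta a + 2 * pi], inside the
       wrapped sector. *)
    have tbk : theta b < theta k by apply: inc.
    have wak := win a k; case: (emp k); rewrite !nmulr_rgt0 //; split.
      by apply: sin_lt0_piDpi; apply/andP; split; lra.
    by apply: sin_lt0_Npi; apply/andP; split; lra.
  have a_first : nat_of_ord a = 0%N.
    apply/eqP; rewrite -leqn0 leqNgt; apply/negP => a0.
    have kn : (a.-1 < n)%N by rewrite prednK // ltnW.
    pose k := Ordinal kn.
    have tka : theta k < theta a by apply: inc; rewrite /= prednK.
    have wkb := win k b; case: (emp k); rewrite !nmulr_rgt0 //; split.
      by apply: sin_lt0_Npi; apply/andP; split; lra.
    by apply: sin_lt0_piDpi; apply/andP; split; lra.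
  by rewrite b_last a_first modnn.
- have sab : 0 < sin (theta b - theta a) by apply: sin_gt0_pi; apply/andP; split; lra.
  left; apply: val_inj => /=; rewrite modn_small ?(leq_ltn_trans ab) //.
  apply/eqP; rewrite eqn_leq ab andbT leqNgt; apply/negP => abS.
  have kn : (a.+1 < n)%N by apply: ltn_trans abS _.
  pose k := Ordinal kn.
  have tak : theta a < theta k by apply: inc.
  have tkb : theta k < theta b by apply: inc.
  by case: (emp k); rewrite !pmulr_rgt0 //; split; apply: sin_gt0_pi; apply/andP; split; lra.
Qed.

Lemma angles_consecutive (R : realType) (n : nat) (theta : 'I_n -> R)
    (a b : 'I_n) :
  (forall i j : 'I_n, (i < j)%N -> theta i < theta j) ->
  (forall i j, theta j < theta i + 2 * pi) ->
  sin (theta b - theta a) != 0 ->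
  (forall k, ~ (0 < sin (theta b - theta a) * sin (theta k - theta a) /\
                0 < sin (theta b - theta a) * sin (theta b - theta k))) ->
  b = ordS a \/ a = ordS b.
Proof.
move=> inc win nz emp.
have [ab|ba|/val_inj ab] := ltngtP a b.
- exact: angles_consecutive_lt inc win nz emp ab.
- apply/or_comm; apply: (angles_consecutive_lt inc win _ _ ba).
    by rewrite -opprB sinN oppr_eq0.
  move=> k [k1 k2]; apply: (emp k); split.
    by rewrite -mulrNN -!sinN !opprB.
  by rewrite -mulrNN -!sinN !opprB.
- by rewrite ab subrr sin0 eqxx in nz.
Qed.

(** * Barycentric coordinates *)

Lemma barycentric_unique (R : realType) (a b c : 'rV[R]_2)
    (u v w u' v' w' : R) : nondegenerate_tri a b c ->
  u + v + w = 1 -> u' + v' + w' = 1 ->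
  u *: a + v *: b + w *: c = u' *: a + v' *: b + w' *: c ->
  [/\ u = u', v = v' & w = w'].
Proof.
set D := cross (b - a) (c - a) => nd s s' e.
(* Cramer's rule: the point determines its coordinates as quotients of signed areas. *)
have coordE (x y z : R) (p : 'rV[R]_2) : x + y + z = 1 ->
    p = x *: a + y *: b + z *: c ->
    y * D = cross (p - a) (c - a) /\ z * D = cross (b - a) (p - a).
  move=> sum ->; rewrite (_ : x = 1 - y - z); last by lra.
  by rewrite /D /cross !mxE; split; ring.
have [vD wD] := coordE _ _ _ _ s erefl.
have [vD' wD'] := coordE _ _ _ _ s' e.
have ev : v = v' by apply: (mulIf nd); rewrite vD vD'.
have ew : w = w' by apply: (mulIf nd); rewrite wD wD'.
by split=> //; lra.
Qed.

Lemma cross_decomp (R : realType) (u v w : 'rV[R]_2) : cross u v != 0 ->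
  w = (cross w v / cross u v) *: u + (cross u w / cross u v) *: v.
Proof.
by rewrite /cross => nd; apply: rV2P; rewrite !mxE; field.
Qed.

Lemma big_set3 (R : zmodType) (V : finType) (F : V -> R) (x y z : V) :
  x != y -> x != z -> y != z ->
  \sum_(i in [set x; y; z]) F i = F x + F y + F z.
Proof.
move=> xy xz yz; rewrite finset.setUC big_setU1 ?inE; last first.
  by rewrite negb_or ![z == _]eq_sym xz yz.
by rewrite big_setU1 ?inE // big_set1 addrC.
Qed.

Section Hull.
Variables (R : realType) (V : finType) (pos : V -> 'rV[R]_2) (x y z : V).
Hypothesis nd : nondegenerate_tri (pos x) (pos y) (pos z).

Let distinct : [/\ x != y, x != z & y != z].
Proof.
by have [xy xz yz] := nondegenerate_neq nd; split;
  [apply: contraNneq xy|apply: contraNneq xz|apply: contraNneq yz] => ->.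
Qed.

Lemma hull_tri (u v w : R) : 0 <= u -> 0 <= v -> 0 <= w -> u + v + w = 1 ->
  hull pos [set x; y; z] (u *: pos x + v *: pos y + w *: pos z).
Proof.
move=> u0 v0 w0 s; have [xy xz yz] := distinct.
exists (fun i => if i == x then u else if i == y then v else w); split.
- by move=> i; case: ifP => // _; case: ifP.
- by rewrite big_set3 // eqxx ![y == _]eq_sym (negbTE xy) eqxx ![z == _]eq_sym
    (negbTE xz) (negbTE yz).
- by rewrite big_set3 // eqxx ![y == _]eq_sym (negbTE xy) eqxx ![z == _]eq_sym
    (negbTE xz) (negbTE yz).
Qed.

Lemma hull_tri_sub (A : {set V}) (p : 'rV[R]_2) :
  A \subset [set x; y; z] -> hull pos A p ->
  exists u v w : R, [/\ [/\ 0 <= u, 0 <= v & 0 <= w], u + v + w = 1,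
    p = u *: pos x + v *: pos y + w *: pos z &
    [/\ x \notin A -> u = 0, y \notin A -> v = 0 & z \notin A -> w = 0]].
Proof.
move=> sA [f [f0 fs fp]]; have [xy xz yz] := distinct.
pose g i := if i \in A then f i else 0.
have gE (M : zmodType) (F : V -> M) : \sum_(i in A) F i =
    \sum_(i in [set x; y; z]) (if i \in A then F i else 0).
  rewrite -big_mkcondr; apply: eq_bigl => i; apply/idP/andP => [iA|[]//].
  by rewrite (fintype.subsetP sA).
exists (g x), (g y), (g z); split.
- by rewrite /g; split; case: ifP.
- by rewrite -[RHS]fs gE big_set3.
- rewrite fp gE big_set3 // /g.
  by do 3![case: ifP => _]; rewrite ?scale0r.
- by rewrite /g; split=> /negbTE ->.
Qed.

Lemma hull_triP (p : 'rV[R]_2) :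
  let D := cross (pos y - pos x) (pos z - pos x) in
  let v := cross (p - pos x) (pos z - pos x) / D in
  let w := cross (pos y - pos x) (p - pos x) / D in
  hull pos [set x; y; z] p <-> [/\ 0 <= 1 - v - w, 0 <= v & 0 <= w].
Proof.
move=> D v w.
have pE : p = (1 - v - w) *: pos x + v *: pos y + w *: pos z.
  rewrite -[LHS](subrK (pos x)) (cross_decomp (p - pos x) nd) -/D -/v -/w.
  by apply: rV2P; rewrite !mxE; ring.
have s1 : 1 - v - w + v + w = 1 by ring.
split=> [/(hull_tri_sub (subxx _))[u' [v' [w' [[u0 v0 w0] s' p' _]]]]|[*]].
  by have [-> -> ->] := barycentric_unique nd s1 s' (etrans (esym pE) p').
by rewrite pE; apply: hull_tri.
Qed.

(** Outside the triangle some barycentric coordinate is negative; it is affine in [s], hence stays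
    negative for small [s]. *)
Lemma near_not_hull_tri (p d : 'rV[R]_2) : ~ hull pos [set x; y; z] p ->
  (\forall s \near 0^'+, ~ hull pos [set x; y; z] (p + s *: d))%classic.
Proof.
have near_lt0 (g k : R) : g < 0 -> (\forall s \near 0^'+, g + s * k < 0)%classic.
  move=> g0; have k1 : 0 < 1 + `|k| by rewrite ltr_pwDl.
  have e0 : 0 < - g / (1 + `|k|) by rewrite divr_gt0 // oppr_gt0.
  near=> s.
  have s0 : 0 < s by near: s; exact: nbhs_right_gt.
  have : s < - g / (1 + `|k|) by near: s; exact: nbhs_right_lt.
  rewrite ltr_pdivlMr // => sg.
  have : s * k <= s * `|k| by rewrite ler_wpM2l ?ler_norm // ltW.
  by lra.
set D := cross (pos y - pos x) (pos z - pos x).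
pose v q := cross (q - pos x) (pos z - pos x) / D.
pose w q := cross (pos y - pos x) (q - pos x) / D.
move=> Np.
have [v0|v0] := ltP (v p) 0.
  apply: filterS (near_lt0 _ (cross d (pos z - pos x) / D) v0) => s lt0 /hull_triP[_ + _].
  by apply/negP; rewrite -ltNge; congr (_ < _) : lt0; rewrite -/D /v /cross !mxE; ring.
have [w0|w0] := ltP (w p) 0.
  apply: filterS (near_lt0 _ (cross (pos y - pos x) d / D) w0) => s lt0 /hull_triP[_ _].
  by apply/negP; rewrite -ltNge; congr (_ < _) : lt0; rewrite -/D /w /cross !mxE; ring.
have [u0|u0] := ltP (1 - v p - w p) 0; last by case: Np; apply/hull_triP.
apply: filterS (near_lt0 _ (- (cross d (pos z - pos x) / D)
  - cross (pos y - pos x) d / D) u0) => s lt0 /hull_triP[+ _ _].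
by apply/negP; rewrite -ltNge; congr (_ < _) : lt0; rewrite -/D /v /w /cross !mxE; ring.
Unshelve. all: by end_near.
Qed.

End Hull.

(** * Neighbours of a vertex *)

Section Star.
Variables (R : realType) (T : triangulation R).
Implicit Types c x y z : vertex T.

Lemma triangle_subset_eq (s t : {set vertex T}) :
  s \in triangles T -> t \in triangles T -> s \subset t -> s = t.
Proof.
by move=> sT tT st; apply/eqP; rewrite eqEcard st (tri_card sT) (tri_card tT).
Qed.

Lemma triangleP (t : {set vertex T}) : t \in triangles T ->
  exists x y z, t = [set x; y; z].
Proof.
move=> tT; have : (2 < #|t|)%N by rewrite tri_card.
move=> /card_gt2P[x [y [z [[xt yt zt] [xy yz zx]]]]].
exists x, y, z; apply/esym/eqP; rewrite eqEcard (tri_card tT).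
rewrite !finset.subUset !finset.sub1set xt yt zt /=.
by rewrite finset.setUC !cardsU1 cards1 !inE negb_or zx [z == y]eq_sym yz xy.
Qed.

(* A neighbour strictly inside the angle of a triangle at [c] would make its
   edge cross the interior of that triangle near [c]. *)
Lemma no_neighbour_in_sector c x y z :
  [set c; x; y] \in triangles T -> Defs.adjacent c z ->
  let u := pos T x - pos T c in let v := pos T y - pos T c in
  let w := pos T z - pos T c in
  0 < cross u v * cross u w -> 0 < cross u v * cross w v -> False.
Proof.
move=> tT [cz [t' tT' /andP[ct' zt']]] u v w uw wv.
have nd : nondegenerate_tri (pos T c) (pos T x) (pos T y) := tri_nondeg tT.
have D0 : cross u v != 0 := nd.
pose a := cross w v / cross u v; pose b := cross u w / cross u v.
have pos_quot g : 0 < cross u v * g -> 0 < g / cross u v.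
  move=> g0; rewrite (_ : _ / _ = cross u v * g / cross u v ^+ 2).
    by rewrite divr_gt0 // exprn_even_gt0.
  by field.
have a0 : 0 < a := pos_quot _ wv.
have b0 : 0 < b := pos_quot _ uw.
have N0 : 0 < 1 + a + b by lra.
(* With this [s] the point [p] at parameter [s] on the edge from [c] to [z] has barycentric
   coordinates [s], [s * a], [s * b] in the triangle, all positive. *)
pose s := (1 + a + b)^-1; have s0 : 0 < s by rewrite invr_gt0.
have s1 : s * (1 + a + b) = 1 by rewrite mulVf ?gt_eqF.
have le_s1 : s <= 1.
  by rewrite -s1 ler_peMr ?(ltW s0) //; lra.
have sa0 : 0 < s * a by rewrite mulr_gt0.
have sb0 : 0 < s * b by rewrite mulr_gt0.
have sum1 : s + s * a + s * b = 1 by rewrite -s1; ring.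
pose p := s *: pos T c + (s * a) *: pos T x + (s * b) *: pos T y.
have pE : p = (1 - s) *: pos T c + s *: pos T z.
  have -> : pos T z = a *: u + b *: v + pos T c.
    by rewrite -[LHS](subrK (pos T c)) -/w [in LHS](cross_decomp w D0).
  by rewrite -[in X in X *: pos T c]sum1; apply: rV2P; rewrite !mxE; ring.
have pt : hull (pos T) [set c; x; y] p by apply: hull_tri => //; exact: ltW.
have pt' : hull (pos T) t' p.
  exists (fun i => if i == c then 1 - s else if i == z then s else 0); split.
  - by move=> i; case: ifP => _; [lra|case: ifP => // _; exact: ltW].
  - rewrite (bigD1 c) //= (bigD1 z) /=; last by rewrite zt' eq_sym.
    rewrite big1 ?eqxx; last by move=> i /andP[/andP[_ /negbTE-> /negbTE->]].
    by rewrite eq_sym (negbTE cz) addr0 subrK.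
  - rewrite (bigD1 c) //= (bigD1 z) /=; last by rewrite zt' eq_sym.
    rewrite big1 ?eqxx; last first.
      by move=> i /andP[/andP[_ /negbTE-> /negbTE->]]; rewrite scale0r.
    by rewrite eq_sym (negbTE cz) addr0.
have [ett'|ntt'] := eqVneq [set c; x; y] t'.
  move: zt'; rewrite -ett' !inE => /orP[/orP[|]|] /eqP ez.
  - by rewrite ez eqxx in cz.
  - by move: uw; rewrite /w ez /cross [X in _ * X](_ : _ = 0) ?mulr0 ?ltxx // mulrC subrr.
  - by move: wv; rewrite /w ez /cross [X in _ * X](_ : _ = 0) ?mulr0 ?ltxx // mulrC subrr.
(* Two distinct triangles share only a face; the positive coordinates of [p] force [x] and [y] into
   [t'], which then has the same three vertices. *)
have : hull (pos T) ([set c; x; y] :&: t') p by rewrite -tri_meet.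
move=> /(hull_tri_sub nd (finset.subsetIl _ _))[u' [v' [w' [_ sum' p' [uz vz wz]]]]].
have [eu ev ew] := barycentric_unique nd sum1 sum' p'.
have inI i (k : R) : (i \notin [set c; x; y] :&: t' -> k = 0) -> 0 < k -> i \in t'.
  move=> k0 kgt0; suff : i \in [set c; x; y] :&: t' by case/setIP.
  by apply: contraLR kgt0 => /k0 ->; rewrite ltxx.
move/eqP: ntt'; apply; apply: triangle_subset_eq => //.
rewrite !finset.subUset !finset.sub1set ct'.
by rewrite (inI _ _ vz) -?ev // (inI _ _ wz) -?ew.
Qed.

Lemma ccw_triangle_consecutive c n (W : 'I_n -> vertex T) (a b : 'I_n) :
  (forall i, Defs.adjacent c (W i)) -> counterclockwise c W ->
  [set c; W a; W b] \in triangles T -> b = ordS a \/ a = ordS b.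
Proof.
move=> adj [r [theta [Wp inc win]]] tT.
have crossW i j : cross (pos T (W i) - pos T c) (pos T (W j) - pos T c) =
    r i * r j * sin (theta j - theta i).
  by rewrite (Wp i).2 (Wp j).2 cross_polar.
have r0 i : 0 < r i := (Wp i).1.
apply: (angles_consecutive inc win).
  apply: contraNneq (tri_nondeg tT) => s0.
  by rewrite crossW s0 mulr0.
move=> k [k1 k2]; apply: (no_neighbour_in_sector tT (adj k)); rewrite !crossW.
  by rewrite mulrACA mulr_gt0 // !mulr_gt0.
by rewrite mulrACA mulr_gt0 // !mulr_gt0.
Qed.

Lemma triangle_consecutive c n (W : 'I_n -> vertex T) (a b : 'I_n) :
  cyclic_order c W -> [set c; W a; W b] \in triangles T ->
  b = ordS a \/ a = ordS b.
Proof.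
move=> [_ adjW [ccw|ccw]] tT.
  by apply: (ccw_triangle_consecutive _ ccw tT) => i; apply/adjW; exists i.
(* Reversing the list turns successors into predecessors, and the claim is symmetric in the two. *)
have ordS_rev (i j : 'I_n) : rev_ord i = ordS (rev_ord j) -> j = ordS i.
  move=> /(congr1 val) /= e; apply: val_inj => /=.
  have := ltn_ord i; have := ltn_ord j.
  case: n i j e {W a b adjW ccw tT} => [[]//|n] i j e.
  move: e; have [->|j0] := eqVneq (j : nat) 0%N.
    rewrite !subSS subn0 modnn => /eqP; rewrite subn_eq0 => ni ? ?.
    have -> : (i : nat) = n by apply/eqP; rewrite eqn_leq ni -ltnS ltn_ord.
    by rewrite modnn.
  move=> + ltj lti; rewrite !subSS modn_small; last by lia.
  by move=> e; rewrite modn_small; lia.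
have tT' : [set c; W (rev_ord (rev_ord a)); W (rev_ord (rev_ord b))] \in triangles T.
  by rewrite !rev_ordK.
have adj i : Defs.adjacent c (W (rev_ord i)) by apply/adjW; exists (rev_ord i).
by case: (ccw_triangle_consecutive adj ccw tT') => /ordS_rev; [right|left].
Qed.

(** Otherwise the given triangle would be the only one at [c], and the points just beyond [c] on the
    line from [x] would leave the domain. *)
Lemma exists_third_neighbour c x y : interior_vertex c ->
  [set c; x; y] \in triangles T ->
  exists z, [/\ Defs.adjacent c z, z != x & z != y].
Proof.
move=> ic tT; apply: contrapT => none.
have nd : nondegenerate_tri (pos T c) (pos T x) (pos T y) := tri_nondeg tT.
have only t : t \in triangles T -> c \in t -> t = [set c; x; y].
  move=> tT' ct; apply: triangle_subset_eq => //; apply/fintype.subsetP => i it.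
  rewrite !inE; have [//|ic'] := eqVneq i c.
  apply/negPn/negP; rewrite negb_or => /andP[ix iy]; apply: none; exists i.
  by split=> //; split; [rewrite eq_sym|exists t => //; rewrite ct].
have pc : hull (pos T) [set c; x; y] (pos T c).
  rewrite (_ : pos T c = 1 *: pos T c + 0 *: pos T x + 0 *: pos T y).
    by apply: hull_tri => //; rewrite !addr0.
  by rewrite !scale0r !addr0 scale1r.
(* Moving from [c] along [d] makes the barycentric coordinate of [x] equal to [- s], which is
   negative. *)
pose d := pos T c - pos T x.
have avoid (t : {set vertex T}) :
    (\forall s \near 0^'+, t \in triangles T -> ~ hull (pos T) t (pos T c + s *: d))%classic.
  have [tT'|_] := boolP (t \in triangles T); last exact: nearW.
  have [ct|ct] := boolP (c \in t).
    rewrite (only t) //; near=> s => _.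
    have s0 : 0 < s by near: s; exact: nbhs_right_gt.
    move=> /(hull_tri_sub nd (subxx _))[u [v [w [[u0 v0 w0] s1 e _]]]].
    have e1 : (1 + s) + - s + 0 = 1 by ring.
    have e2 : pos T c + s *: d = (1 + s) *: pos T c + - s *: pos T x + 0 *: pos T y.
      by apply: rV2P; rewrite !mxE; ring.
    have [_ ev _] := barycentric_unique nd e1 s1 (etrans (esym e2) e).
    by lra.
  have [x' [y' [z' et]]] := triangleP tT'.
  (* A triangle without the vertex [c] misses the point [c]: the common face would give [c] the
     coordinate 0 instead of 1. *)
  have nc : ~ hull (pos T) t (pos T c).
    move=> pct.
    have tt : [set c; x; y] != t.
      by apply: contraNneq ct => <-; rewrite !inE eqxx.
    have : hull (pos T) ([set c; x; y] :&: t) (pos T c) by rewrite -tri_meet.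
    move=> /(hull_tri_sub nd (finset.subsetIl _ _))[u [v [w [_ s1 e [uz _ _]]]]].
    have e1 : 1 + 0 + 0 = 1 :> R by rewrite !addr0.
    have e2 : pos T c = 1 *: pos T c + 0 *: pos T x + 0 *: pos T y.
      by rewrite !scale0r !addr0 scale1r.
    have [eu _ _] := barycentric_unique nd e1 s1 (etrans (esym e2) e).
    by move/eqP: eu; rewrite uz ?oner_eq0 // inE (negbTE ct) andbF.
  have nd' : nondegenerate_tri (pos T x') (pos T y') (pos T z').
    by apply: tri_nondeg; rewrite -et.
  rewrite et in nc *.
  by apply: filterS (near_not_hull_tri nd' d nc) => s.
have inside : (\forall s \near 0^'+, domain T (pos T c + s *: d))%classic.
  have cont : ((pos T c + s *: d) @[s --> (0 : R)] --> pos T c)%classic.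
    rewrite -[X in (_ --> X)%classic]addr0 -(scale0r d).
    apply: cvgD; first exact: cvg_cst.
    exact: (@scalel_continuous R _ d 0).
  have near0 : (\forall s \near (0 : R), domain T (pos T c + s *: d))%classic := cont _ ic.
  exact: cvg_within near0.
(* There are finitely many triangles, so one small [s] avoids them all. *)
have outside := filter_forall (at_right_proper_filter (0 : R)) avoid.
have [s [[t tT' ht] no]] := filter_ex (filterI inside outside).
exact: (no t).
Unshelve. all: by end_near.
Qed.

End Star.

(** * Coefficients of a wagon wheel functional *)

(** A third index forces [n] to be at least 3, so two cyclic steps do not return to the start. *)
Lemma ordS2_neq n (a k : 'I_n) : k != a -> k != ordS a -> ordS (ordS a) != a.
Proof.
rewrite -!val_eqE /=; have := ltn_ord a; have := ltn_ord k.
move: (nat_of_ord a) (nat_of_ord k) => {a k} i j jn iN.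
have [iS|iS] := ltnP i.+1 n.
  rewrite (modn_small iS); have [iSS|iSS] := ltnP i.+2 n.
    by rewrite modn_small //; lia.
  by rewrite (_ : i.+2 = n) ?modnn; lia.
have <- : i.+1 = n by lia.
by rewrite modnn => ij j0; rewrite modn_small; lia.
Qed.

Section Coefficients.
Variables (R : realType) (T : triangulation R).
Implicit Types c x y z : vertex T.

Lemma coefficientC (F : {linear elongations T -> R^o}) x y :
  coefficient F x y = coefficient F y x.
Proof. by rewrite /coefficient finset.setUC. Qed.

Lemma triangle_neq c x y : [set c; x; y] \in triangles T ->
  [/\ c != x, c != y & x != y].
Proof.
move=> /tri_nondeg /nondegenerate_neq[cx cy xy].
by split; [apply: contraNneq cx|apply: contraNneq cy|apply: contraNneq xy] => ->.
Qed.

Lemma triangle_adjacent c x y : [set c; x; y] \in triangles T ->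
  Defs.adjacent c x /\ Defs.adjacent c y.
Proof.
move=> tT; have [cx cy _] := triangle_neq tT.
by split; split=> //; exists [set c; x; y]; rewrite ?inE ?eqxx ?orbT.
Qed.

Lemma adjacent_neq c x : Defs.adjacent c x -> (x == c) = false.
Proof. by case; rewrite eq_sym => /negbTE. Qed.

(** No rim edge contains [c], and [x] is listed once, so a single spoke term survives. The two
    triangles identify [y] and [z] with the two cyclic neighbours of [x]. *)
Lemma coefficient_spoke c x y z n (W : 'I_n -> vertex T) :
  cyclic_order c W -> [set c; x; y] \in triangles T ->
  [set c; x; z] \in triangles T -> y != z ->
  coefficient (wagon_wheel c W) c x =
  - (cos (angle (pos T c) (pos T x) (pos T y)) / dist_line (pos T c) (pos T x) (pos T y)
   + cos (angle (pos T c) (pos T x) (pos T z)) / dist_line (pos T c) (pos T x) (pos T z)).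
Proof.
move=> hW ty tz yz; have [inj adj _] := hW.
have adjW i : Defs.adjacent c (W i) by apply/adj; exists i.
have [/adj[b xb] /adj[a ya]] := triangle_adjacent ty.
have [_ /adj[d zd]] := triangle_adjacent tz.
subst x y z.
have neighbour k : [set c; W b; W k] \in triangles T -> k = ordS b \/ k = ord_pred b.
  by case/(triangle_consecutive hW) => [|->]; [left|right; rewrite ordSK].
rewrite /coefficient /= /wagon_wheel big1 => [|i _]; last first.
  rewrite ffunE (_ : _ == _ = false) ?mul0r //; apply/negP => /eqP/setP/(_ c).
  by rewrite !inE eqxx ![c == _]eq_sym !(adjacent_neq (adjW _)).
rewrite sub0r (bigD1 b) //= big1 => [|i ib]; last first.
  rewrite ffunE (_ : _ == _ = false) ?mulr0 //; apply/negP => /eqP/setP/(_ (W i)).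
  rewrite !inE eqxx orbT (adjacent_neq (adjW _)) /= => /esym/eqP/inj ib'.
  by rewrite ib' eqxx in ib.
rewrite ffunE eqxx mulr1 addr0 ord_predK (dist_lineC _ (pos T (W (ord_pred b)))).
(* Being distinct, [y] and [z] take one side each; either assignment gives the same sum. *)
have [ey|ey] := neighbour _ ty; have [ez|ez] := neighbour _ tz; rewrite ey ez in yz *.
- by case/eqP: yz.
- reflexivity.
- rewrite addrC; reflexivity.
- by case/eqP: yz.
Qed.

Lemma coefficient_rim c x y n (W : 'I_n -> vertex T) :
  interior_vertex c -> cyclic_order c W -> [set c; x; y] \in triangles T ->
  coefficient (wagon_wheel c W) x y = (dist_line (pos T c) (pos T x) (pos T y))^-1.
Proof.
move=> ic hW; have [inj adj _] := hW.
have adjW i : Defs.adjacent c (W i) by apply/adj; exists i.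
suff ordered a : [set c; W a; W (ordS a)] \in triangles T ->
    coefficient (wagon_wheel c W) (W a) (W (ordS a)) =
    (dist_line (pos T c) (pos T (W a)) (pos T (W (ordS a))))^-1.
  move=> tT; have [/adj[a xa] /adj[b yb]] := triangle_adjacent tT; subst x y.
  case: (triangle_consecutive hW tT) => e; subst; first exact: ordered.
  rewrite coefficientC dist_lineC; apply: ordered.
  by rewrite finset.setUAC.
move=> tT; have [_ _ ab] := triangle_neq tT.
have [z [/adj[k <-] ka kb]] := exists_third_neighbour ic tT.
(* In a wheel with two rim vertices the edges at [a] and at [ordS a] would be the same set and count
   twice. *)
have SSa : ordS (ordS a) != a.
  by apply: (@ordS2_neq _ _ k); [apply: contraNneq ka|apply: contraNneq kb] => ->.
rewrite /coefficient /= /wagon_wheel [X in _ - X]big1 => [|i _]; last first.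
  rewrite ffunE (_ : _ == _ = false) ?mulr0 //; apply/negP => /eqP/setP/(_ c).
  by rewrite !inE eqxx ![c == _]eq_sym !(adjacent_neq (adjW _)).
rewrite subr0 (bigD1 a) //= big1 => [|i ia].
  by rewrite ffunE eqxx mul1r addr0.
rewrite ffunE (_ : _ == _ = false) ?mul0r //; apply/negP => /eqP/setP e.
have Wi j : (W i == W j) = (i == j) by apply/eqP/eqP => [/inj|->].
(* A second index [i] with the same rim edge must be [ordS a], and its successor must be [a]. *)
have := e (W i); rewrite !inE eqxx /= !Wi (negbTE ia) /= => /esym/eqP ei.
have := e (W a); rewrite ei !inE eqxx /= => /orP[/eqP|/eqP/inj] ea.
  by rewrite ea eqxx in ab.
by rewrite -ea eqxx in SSa.
Qed.

End Coefficients.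

(** * Cancellation over the four wheels *)

Theorem lemma6 (R : realType) (T : triangulation R) (V0 V1 V2 V3 : vertex T)
  (hE : interior_edge V0 V2)
  (h012 : [set V0; V1; V2] \in triangles T)
  (h023 : [set V0; V2; V3] \in triangles T)
  (nd012 : nondegenerate_tri (pos T V0) (pos T V1) (pos T V2))
  (nd023 : nondegenerate_tri (pos T V0) (pos T V2) (pos T V3))
  (hopp : opposite_sides (pos T V0) (pos T V2) (pos T V1) (pos T V3))
  (hint0 : interior_vertex V0) (hint1 : interior_vertex V1)
  (hint2 : interior_vertex V2) (hint3 : interior_vertex V3)
  (n0 n1 n2 n3 : nat)
  (W0 : 'I_n0 -> vertex T) (W1 : 'I_n1 -> vertex T)
  (W2 : 'I_n2 -> vertex T) (W3 : 'I_n3 -> vertex T)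
  (hW0 : cyclic_order V0 W0) (hW1 : cyclic_order V1 W1)
  (hW2 : cyclic_order V2 W2) (hW3 : cyclic_order V3 W3) :
  coefficient (wagon_wheel V0 W0 \+ wagon_wheel V1 W1
               \+ wagon_wheel V2 W2 \+ wagon_wheel V3 W3) V0 V2 = 0.
Proof.
(* If they coincided, the product in [opposite_sides] would be a square. *)
have n13 : V1 != V3.
  apply: contraTneq hopp => ->.
  by rewrite /opposite_sides -leNgt -expr2 sqr_ge0.
have t021 : [set V0; V2; V1] \in triangles T by rewrite finset.setUAC.
have rot x y z : [set x; y; z] = [set z; x; y] :> {set vertex T}.
  by rewrite finset.setUC finset.setUA.
have t201 : [set V2; V0; V1] \in triangles T by rewrite -rot.
have t203 : [set V2; V0; V3] \in triangles T by rewrite [[set V2; V0]]finset.setUC.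
have t102 : [set V1; V0; V2] \in triangles T by rewrite -rot.
have t302 : [set V3; V0; V2] \in triangles T by rewrite -rot.
have c0 := coefficient_spoke hW0 t021 h023 n13.
have c2 := coefficient_spoke hW2 t201 t203 n13.
have c1 := coefficient_rim hint1 hW1 t102.
have c3 := coefficient_rim hint3 hW3 t302.
rewrite coefficientC in c2.
rewrite (rim_spoke (tri_nondeg t021)) in c1.
rewrite (rim_spoke (tri_nondeg h023)) in c3.
transitivity (coefficient (wagon_wheel V0 W0) V0 V2 + coefficient (wagon_wheel V1 W1) V0 V2
  + coefficient (wagon_wheel V2 W2) V0 V2 + coefficient (wagon_wheel V3 W3) V0 V2 : R).
  by [].
(* [a] and [d] are the cosine quotients at [V2] and [V0] in the triangle with [V1]; [b] and [e] are
   those in the triangle with [V3]. *)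
have cancel (a b d e : R) : - (a + b) + (a + d) - (d + e) + (b + e) = 0 by ring.
rewrite c0 c1 c2 c3.
exact: cancel.
Qed.
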